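(* Let $\mathcal{M}$ be a matroid of rank $c\geq 1$ on $[n]$, let $J=J(\mathcal{M})\subseteq R$, and order $G(J)$ by the iterated-contraction order $\preceq$ determined by an ordered basis $(v_1,\ldots,v_c)$ of $\mathcal{M}$ and arbitrary total orders on the sets $G(J_i)-G(J_{i+1})$ (see context). For every $N\in G(J)$ with $N\neq\min G(J)$, let $\mathbb{F}^{C_N}_\bullet$ be a minimal multigraded free resolution of $R/C_N$, where $C_N=J_{\prec N}:N$. Then for every $h\geq 1$, $$\mathrm{mdeg}\big(\mathbb{F}^{C_N}_{h-1}\langle N\rangle\big)\subseteq G(SF_h(J)).$$ Consequently, for every $N\in G(J)$ and every $h\geq 1$, the multidegrees appearing in homological degree $h$ of the resolution $\mathbb{I}^N_\bullet$ of $R/J_{\preceq N}$ by iterated mapping cones satisfy $\mathrm{mdeg}(\mathbb{I}^N_h)\subseteq G(SF_h(J))$. In particular, the resolution of $R/J$ by iterated mapping cones with respect to this order is a minimal free resolution.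
   Context: Let $\mathbb{K}$ be a field, $R=\mathbb{K}[x_1,\ldots,x_n]$. Matroids are identified with their independence complexes; $\mathcal{B}(\mathcal{M})$ denotes the set of bases. For $F\subseteq[n]$ let $\mathfrak p_F=(x_i: i\in F)$. The cover ideal of a matroid $\mathcal{M}$ on a ground set $E\subseteq[n]$ is $J(\mathcal{M})=\bigcap_{F\in\mathcal{B}(\mathcal{M})}\mathfrak p_F$ (formed in $\mathbb{K}[x_i:i\in E]$ and extended to $R$). For an independent set $A$, $\mathcal{M}/A$ is the contraction: the matroid on $[n]-A$ whose independent sets are the $I$ with $I\cup A$ independent in $\mathcal{M}$. For a monomial ideal $I$, $G(I)$ is its set of minimal monomial generators. For a squarefree monomial ideal $I$ with minimal primes $\mathfrak q_1,\ldots,\mathfrak q_t$, $I^{(\ell)}=\bigcap_j \mathfrak q_j^{\ell}$, and $SF_\ell(I)$ is the ideal generated by the squarefree monomials in $I^{(\ell)}$ (it is $0$ if there are none). Order: set $J_i=J(\mathcal{M}/\{v_1,\ldots,v_i\})$ for $0\le i\le c$ (so $J_0=J$, $J_c=0$); one has $G(J_c)\subseteq G(J_{c-1})\subseteq\cdots\subseteq G(J_0)$. Choose any total order on each $G(J_i)-G(J_{i+1})$. For $N\in G(J)$ let $i_N$ be the index with $N\in G(J_i)-G(J_{i+1})$. Define $N\prec N'$ iff $i_N>i_{N'}$, or $i_N=i_{N'}$ and $N$ precedes $N'$ in the chosen order on $G(J_{i_N})-G(J_{i_N+1})$. Notation: $J_{\preceq N}$ (resp. $J_{\prec N}$) is the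 ideal generated by the $N'\in G(J)$ with $N'\preceq N$ (resp. $N'\prec N$). For a multigraded free module $F$, $F\langle N\rangle$ is $F$ with multidegrees shifted by the monomial $N$, and $\mathrm{mdeg}(F)$ is the set of monomials that are multidegrees of a homogeneous basis of $F$. Iterated mapping cones: if $N=\min G(J)$, $\mathbb{I}^N_\bullet$ is the minimal free resolution $0\to R(-N)\xrightarrow{N}R$ of $R/(N)$. If $N$ has predecessor $N^-$, then $\mathbb{I}^N_\bullet$ is the mapping cone of a comparison map $\mathbb{F}^{C_N}_\bullet\langle N\rangle\to \mathbb{I}^{N^-}_\bullet$ lifting multiplication by $N$ in the exact sequence $0\to R/C_N\xrightarrow{\cdot N}R/J_{\prec N}\to R/J_{\preceq N}\to 0$; it is a free resolution of $R/J_{\preceq N}$. *)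

(* Defs.v *)
From HB Require Import structures.
From mathcomp Require Import all_boot all_order all_algebra.
From mathcomp Require Import mpoly.
Set Implicit Arguments. Unset Strict Implicit. Unset Printing Implicit Defensive.
Import GRing.Theory.
Local Open Scope ring_scope.

Section MonomialIdeals.
Variable n : nat.
Local Notation mon := ('X_{1..n}).

(* Monomial ideals of R = K[x_1..x_n] are represented by the set of monomials
   (exponent vectors) they contain. *)
Definition mideal := mon -> Prop.

Definition mdivides (a b : mon) : Prop := forall i, (a i <= b i)%N.

Definition mgens (I : mideal) : mideal :=
  fun m => I m /\ forall m', I m' -> mdivides m' m -> m' = m.

Definition mprime (F : {set 'I_n}) : mideal := fun m => exists2 i, i \in F & (0 < m i)%N.

Definition mprime_pow (F : {set 'I_n}) (l : nat) : mideal :=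
  fun m => (l <= \sum_(i in F) m i)%N.

Definition msub (I I' : mideal) : Prop := forall m, I m -> I' m.

(* minimal primes of a monomial ideal (these are monomial primes p_F) *)
Definition minprime (I : mideal) (F : {set 'I_n}) : Prop :=
  msub I (mprime F) /\ forall F', msub I (mprime F') -> F' \subset F -> F' = F.

Definition sympow (I : mideal) (l : nat) : mideal :=
  fun m => forall F, minprime I F -> mprime_pow F l m.

Definition msqfree (m : mon) : Prop := forall i, (m i <= 1)%N.

Definition SF (I : mideal) (l : nat) : mideal :=
  fun m => exists s, [/\ msqfree s, mdivides s m & sympow I l s].

Definition is_matroid (B : {set {set 'I_n}}) : Prop :=
  B != set0 /\
  forall B1 B2, B1 \in B -> B2 \in B -> forall x, x \in B1 :\: B2 ->
    exists2 y, y \in B2 :\: B1 & (B1 :\ x) :|: [set y] \in B.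

Definition cover_ideal (B : {set {set 'I_n}}) : mideal :=
  fun m => forall F, F \in B -> mprime F m.

(* bases of the contraction M/A (A independent): the I disjoint from A
   with I \cup A a basis of M *)
Definition contr_bases (B : {set {set 'I_n}}) (A : {set 'I_n}) : {set {set 'I_n}} :=
  [set I : {set 'I_n} | [disjoint I & A] && ((I :|: A) \in B)].

Section Order.
Variables (c : nat) (B : {set {set 'I_n}}) (v : 'I_c -> 'I_n).

Definition vset (i : nat) : {set 'I_n} := [set v k | k : 'I_c & (k < i)%N].

Definition Jc (i : nat) : mideal := cover_ideal (contr_bases B (vset i)).

Definition piece (i : nat) : mideal := fun N => mgens (Jc i) N /\ ~ mgens (Jc i.+1) N.

Variable ord : mon -> mon -> Prop.

Definition prec (N N' : mon) : Prop :=
  exists i i', [/\ (i < c)%N, (i' < c)%N, piece i N, piece i' N' &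
                   ((i' < i)%N \/ (i = i' /\ ord N N'))].

Definition GJ : mideal := mgens (cover_ideal B).

Definition is_min_elt (N : mon) : Prop := GJ N /\ forall N', GJ N' -> ~ prec N' N.
Definition is_max_elt (N : mon) : Prop := GJ N /\ forall N', GJ N' -> ~ prec N N'.
Definition is_pred (Nm N : mon) : Prop :=
  [/\ GJ Nm, GJ N, prec Nm N & forall N', GJ N' -> ~ (prec Nm N' /\ prec N' N)].

Definition colon_ideal (N : mon) : mideal :=
  fun m => exists N', [/\ GJ N', prec N' N & mdivides N' (mnm_add m N)].

End Order.

End MonomialIdeals.

Section Complexes.
Variables (K : fieldType) (n : nat).
Local Notation mon := ('X_{1..n}).
Local Notation R := {mpoly K[n]}.

Definition in_mideal (I : mideal n) (p : R) : Prop := forall m, m \in msupp p -> I m.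

(* a complex of finitely generated multigraded free R-modules
     ... -> F_{i+1} --dm i--> F_i -> ... -> F_0,
   F_i = \oplus_{j < rk i} R(-deg i j), maps acting on column vectors *)
Record cx := Cx {
  rk : nat -> nat;
  deg : forall i, 'I_(rk i) -> mon;
  dm : forall i, 'M[R]_(rk i, rk i.+1)
}.
Arguments deg : clear implicits.

(* p is a multihomogeneous map R(-b) -> R(-a) *)
Definition hom_entry (p : R) (a b : mon) : Prop :=
  exists k : K, p = k *: 'X_[mnm_sub b a] /\ (k != 0 -> lem a b).

Definition is_res (I : mideal n) (F : cx) : Prop :=
  [/\ rk F 0 = 1%N /\ (forall j, deg F 0 j = mnm0),
      (forall i a b, hom_entry (dm F i a b) (deg F i a) (deg F i.+1 b)),
      (forall i, dm F i *m dm F i.+1 = 0),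
      (forall i (x : 'cV[R]_(rk F i.+1)), dm F i *m x = 0 ->
          exists y : 'cV[R]_(rk F i.+2), dm F i.+1 *m y = x) &
      (forall p : R, in_mideal I p <->
          exists y : 'cV[R]_(rk F 1), forall j, (dm F 0 *m y) j ord0 = p)].

Definition is_minimal (F : cx) : Prop :=
  forall i a b, (dm F i a b)@_mnm0 = 0.

Definition is_min_res (I : mideal n) (F : cx) : Prop := is_res I F /\ is_minimal F.

Definition mdeg_shift (F : cx) (N : mon) (i : nat) : mideal n :=
  fun m => exists j, mnm_add (deg F i j) N = m.

Definition mdegs (F : cx) (i : nat) : mideal n := mdeg_shift F mnm0 i.

(* comparison map phi : F<N> -> G lifting multiplication by N on F_0 = G_0 = R *)
Definition is_comparison (F G : cx) (N : mon) (phi : forall i, 'M[R]_(rk G i, rk F i)) : Prop :=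
  [/\ (forall a b, phi 0%N a b = 'X_[N]),
      (forall i a b, hom_entry (phi i a b) (deg G i a) (mnm_add (deg F i b) N)) &
      (forall i, dm G i *m phi i.+1 = phi i *m dm F i)].

Arguments is_comparison : clear implicits.

(* the mapping cone of phi: cone_i = G_i (+) F_{i-1}<N> *)
Definition rkS (F : cx) (i : nat) : nat := match i with 0 => 0 | j.+1 => rk F j end.

Definition dS (F : cx) (i : nat) : 'M[R]_(rkS F i, rkS F i.+1) :=
  match i return 'M[R]_(rkS F i, rkS F i.+1) with
  | 0 => 0
  | j.+1 => dm F j
  end.

Definition degS (F : cx) (N : mon) (i : nat) : 'I_(rkS F i) -> mon :=
  match i return 'I_(rkS F i) -> mon with
  | 0 => fun _ => mnm0
  | j.+1 => fun b => mnm_add (deg F j b) N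
  end.

Definition cone (G F : cx) (N : mon) (phi : forall i, 'M[R]_(rk G i, rk F i)) : cx :=
  @Cx (fun i => rk G i + rkS F i)%N
      (fun i j => match split j with inl a => deg G i a | inr b => @degS F N i b end)
      (fun i => block_mx (dm G i) (phi i) 0 (- dS F i)).

Arguments cone : clear implicits.

Definition iter_cone (c : nat) (B : {set {set 'I_n}}) (v : 'I_c -> 'I_n)
    (ord : mon -> mon -> Prop) (I : mon -> cx) : Prop :=
  (forall N0, is_min_elt B v ord N0 ->
     [/\ rk (I N0) 0 = 1%N /\ rk (I N0) 1 = 1%N, (forall i, (2 <= i)%N -> rk (I N0) i = 0%N),
         (forall j, deg (I N0) 0 j = mnm0), (forall j, deg (I N0) 1 j = N0) &
         (forall a b, dm (I N0) 0 a b = 'X_[N0])]) /\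
  (forall Nm N, is_pred B v ord Nm N ->
     exists (F : cx) (phi : forall i, 'M[R]_(rk (I Nm) i, rk F i)),
       [/\ is_min_res (colon_ideal B v ord N) F,
           is_comparison F (I Nm) N phi &
           I N = cone (I Nm) F N phi]).

End Complexes.
Arguments rk {K n} _ _.
Arguments deg {K n} _ _ _.
Arguments dm {K n} _ _.

(* Main.v *)
Require Import Defs.
From HB Require Import structures.
From mathcomp Require Import all_boot all_order all_algebra.
From mathcomp Require Import mpoly zify.
From Stdlib Require Import Classical ClassicalEpsilon.

(* The minimal generators of J are the monomials x^(E-H), H a hyperplane of the
   matroid, and those of SF_h(J) include the x^(E-G), G a flat of corank h. For
   a flat T and a set A in T let I(A,T) be generated by the x^(T-H), H a flat of
   corank 1 in T containing A. If N = x^(E-H) lies in G(J_i) - G(J_{i+1}), then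
   C_N = I({v_1..v_i}, H). By induction on rank T and on the corank of A in T,
   I(A,T) has a resolution, obtained from iterated mapping cones, whose
   multidegrees in homological degree h are x^(T-G), G a flat of corank h in T.
   A minimal resolution only uses multidegrees of any other resolution, so this
   controls C_N. The iterated cone is then minimal since G(SF_h(J)) and
   G(SF_{h+1}(J)) are disjoint. *)

Set Implicit Arguments.
Unset Strict Implicit.
Unset Printing Implicit Defensive.
Import GRing.Theory.

(** * Rank and flats of a matroid *)

Section Matroid.
Variables (n : nat) (B : {set {set 'I_n}}).
Hypothesis matB : is_matroid B.
Implicit Types (S T A F I : {set 'I_n}).

Definition indep I := [exists F in B, I \subset F].

(** This is the matroid rank: the independent subsets of [S] are the subsets of the sets [S :&: F],
    [F] a basis. *)
Definition rank S := \max_(F in B) #|S :&: F|.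

Lemma basis_exists : exists F, F \in B.
Proof. by case: matB => /set0Pn. Qed.

Lemma card_basis F F' : F \in B -> F' \in B -> #|F| = #|F'|.
Proof.
have [_ exch] := matB.
have [m] := ubnP #|F :\: F'|; elim: m F => // m IH F Fm FB F'B.
have [e|[x xF]] := set_0Vmem (F :\: F').
  (* If [F] were properly contained in [F'], exchanging an element of [F'] outside [F] would need an
     element of the empty set [F :\: F']. *)
  have [->|ne] := eqVneq F F'; first by [].
  have : F \proper F' by rewrite properEneq ne -setD_eq0 e eqxx.
  case/properP=> _ [x xF' xF].
  have [y] : exists2 y, y \in F :\: F' & (F' :\ x) :|: [set y] \in B.
    by apply: exch => //; rewrite inE xF.
  by rewrite e inE.
have [y yF' GB] := exch F F' FB F'B x xF.
move: xF yF'; rewrite !inE => /andP[xF' xF] /andP[yF yF'].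
have cG : #|(F :\ x) :|: [set y]| = #|F|.
  rewrite setUC cardsU1 !inE (negbTE yF) andbF (cardsD1 x F) xF.
  by [].
rewrite -cG; apply: IH => //; apply: leq_trans (_ : #|F :\: F'| <= _)%N; last exact: Fm.
apply: proper_card; apply/properP; split.
  apply/subsetP=> z; rewrite !inE => /andP[zF' /orP[/andP[_ ->]|/eqP zy]]; first by rewrite zF'.
  by rewrite zy yF' in zF'.
exists x; rewrite !inE ?xF' ?xF // eqxx /=.
by apply/negP=> /eqP xy; rewrite -xy xF in yF.
Qed.

(* Among the bases containing I, one with the largest intersection with a basis
   containing I' meets I' outside I. *)
Lemma indep_augment I I' : indep I -> indep I' -> (#|I| < #|I'|)%N ->
  exists2 y, y \in I' :\: I & indep (y |: I).
Proof.
have [_ exch] := matB.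
move=> /existsP[F0 IF0] /existsP[F' /andP[F'B I'F']] lt.
pose P F := (F \in B) && (I \subset F).
have [F /andP[FB IF] maxF] := @arg_maxnP _ F0 P (fun F => #|F :&: F'|) IF0.
have [[y]|none] := classic (exists y, y \in (I' :\: I) :&: F).
  rewrite !inE => /andP[/andP[yI yI'] yF]; exists y; first by rewrite inE yI.
  by apply/existsP; exists F; rewrite FB subUset sub1set yF.
(* Exchanging an element of [F] outside [I] and [F'] for one of [F'] would keep [I] and enlarge the
   intersection with [F']. *)
have FIF' : F \subset I :|: F'.
  apply/subsetP=> x xF; rewrite inE; apply: contraT; rewrite negb_or => /andP[xI xF'].
  have [|y yF' GB] := exch F F' FB F'B x; first by rewrite inE xF'.
  have : P ((F :\ x) :|: [set y]).
    rewrite /P GB; apply/subsetP=> z zI; rewrite !inE (subsetP IF _ zI) andbT.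
    by case: eqP => // zx; rewrite -zx zI in xI.
  move/maxF => /=; rewrite leqNgt => /negP[]; apply: proper_card; apply/properP.
  move: yF'; rewrite inE => /andP[yF yF']; split; last by exists y; rewrite !inE ?eqxx ?orbT ?yF' // (negbTE yF).
  apply/subsetP=> z; rewrite !inE => /andP[zF zF']; rewrite zF zF' !andbT.
  by case: eqP => // zx; rewrite -zx zF' in xF'.
(* As [F] and [F'] have equal size, this inclusion bounds the size of [I' :\: I] by that of
   [I :\: F'], hence of [I :\: I'], against [#|I| < #|I'|]. *)
have Fsub : F \subset (I :\: F') :|: (F' :\: (I' :\: I)).
  apply/subsetP=> x xF; have := subsetP FIF' _ xF; rewrite !inE.
  case xF': (x \in F') => /=; rewrite ?andbT ?andbF ?orbF ?orbT // => _.
  by apply/negP=> /andP[xI xI']; apply: none; exists x; rewrite !inE xI xI' xF.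
have := leq_trans (subset_leq_card Fsub) (leq_card_setU _ _).
rewrite (card_basis FB F'B) (cardsD F' (I' :\: I)).
have -> : F' :&: (I' :\: I) = I' :\: I.
  by apply/setIidPr; apply: subset_trans I'F'; apply: subsetDl.
have : (#|I' :\: I| <= #|F'|)%N.
  by apply: subset_leq_card; apply: subset_trans I'F'; apply: subsetDl.
have : (#|I :\: F'| <= #|I :\: I'|)%N by apply: subset_leq_card; apply: setDS.
have := cardsID I' I; have := cardsID I I'; rewrite (setIC I' I); move: lt.
move: #|I| #|I'| #|F'| #|I :\: F'| #|I' :\: I| #|I :\: I'| #|I :&: I'|; lia.
Qed.

Lemma indep_sub I I' : indep I' -> I \subset I' -> indep I.
Proof.
by case/existsP=> F /andP[FB s] II'; apply/existsP; exists F; rewrite FB (subset_trans II').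
Qed.

Lemma rank_indep S I : indep I -> I \subset S -> (#|I| <= rank S)%N.
Proof.
case/existsP=> F /andP[FB IF] IS; apply: leq_trans (leq_bigmax_cond _ FB).
by apply: subset_leq_card; rewrite subsetI IS.
Qed.

(** A largest independent set between [A] and [S] works: otherwise it could be augmented from
    [S :&: F], where the basis [F] attains the rank of [S]. *)
Lemma indep_extend S A : indep A -> A \subset S ->
  exists I, [/\ indep I, A \subset I, I \subset S & #|I| = rank S].
Proof.
move=> iA AS; pose P I := [&& indep I, A \subset I & I \subset S].
have PA : P A by rewrite /P iA subxx.
have [I /and3P[iI AI IS] maxI] := @arg_maxnP _ A P (fun I => #|I|) PA.
exists I; split=> //; apply/eqP; rewrite eqn_leq rank_indep //= leqNgt; apply/negP=> lt.
have [F0 F0B] := basis_exists.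
have [F FB rF] : {F | F \in B & rank S = #|S :&: F|}.
  by apply: eq_bigmax_cond; apply/card_gt0P; exists F0.
have iSF : indep (S :&: F) by apply/existsP; exists F; rewrite FB subsetIr.
rewrite rF in lt; have [y] := indep_augment iI iSF lt.
rewrite !inE => /andP[yI /andP[yS _]] iy.
have : P (y |: I).
  by rewrite /P iy subUset sub1set yS IS /= andbT; apply: subset_trans AI (subsetUr _ _).
by move/maxI => /=; rewrite cardsU1 yI add1n ltnn.
Qed.

Lemma rank_witness S : exists I, [/\ indep I, I \subset S & #|I| = rank S].
Proof.
have [F FB] := basis_exists.
have i0 : indep set0 by apply/existsP; exists F; rewrite FB sub0set.
by have [I [? _ ? ?]] := indep_extend i0 (sub0set S); exists I.
Qed.

Lemma rankS S T : S \subset T -> (rank S <= rank T)%N.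
Proof.
by move=> ST; have [I [iI IS <-]] := rank_witness S; apply: rank_indep => //; apply: subset_trans ST.
Qed.

Lemma rankU1 x S : (rank (x |: S) <= (rank S).+1)%N.
Proof.
have [I [iI IS <-]] := rank_witness (x |: S).
have le : (#|I :\ x| <= rank S)%N.
  apply: rank_indep; first by apply: indep_sub iI (subsetDl _ _).
  by rewrite subDset.
by rewrite (cardsD1 x I); case: (x \in I); rewrite ?add1n ?ltnS // add0n leqW.
Qed.

(** A local form of submodularity. Extend a maximal independent set of [S] to one of [T]; if [x]
    raised the rank of [T], the latter could be augmented, necessarily by [x], and then so could the
    former. *)
Lemma rankU1_sub x S T : S \subset T -> rank (x |: S) = rank S -> rank (x |: T) = rank T.
Proof.
move=> ST rx; apply/eqP; rewrite eqn_leq (rankS (subsetUr _ _)) andbT leqNgt; apply/negP=> lt.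
have [I [iI IS cI]] := rank_witness S.
have [I1 [iI1 II1 I1T cI1]] := indep_extend iI (subset_trans IS ST).
have [J [iJ JT cJ]] := rank_witness (x |: T).
have [|y] := indep_augment iI1 iJ; first by rewrite cI1 cJ.
rewrite inE => /andP[yI1 yJ] iy.
have := subsetP JT _ yJ; rewrite !inE => /orP[/eqP yx|yT]; last first.
  have : (#|y |: I1| <= rank T)%N by apply: rank_indep => //; rewrite subUset sub1set yT.
  by rewrite cardsU1 yI1 cI1 add1n ltnn.
have : (#|x |: I| <= rank (x |: S))%N.
  apply: rank_indep; first by apply: indep_sub iy _; rewrite yx setUS.
  exact: setUS.
have xI : x \notin I by apply: contra yI1; rewrite yx; apply: (subsetP II1).
by rewrite cardsU1 xI cI rx add1n ltnn.
Qed.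

Lemma rank_span S T : (forall z, z \in T -> rank (z |: S) = rank S) ->
  rank (S :|: T) = rank S.
Proof.
have [m] := ubnP #|T|; elim: m T => // m IH T Tm h.
have [->|[x xT]] := set_0Vmem T; first by rewrite setU0.
have rU : rank (S :|: (T :\ x)) = rank S.
  apply: IH => [|z]; first by rewrite (cardsD1 x T) xT in Tm.
  by rewrite inE => /andP[_ /h].
rewrite -(setD1K xT) setUCA -rU; apply: rankU1_sub (subsetUl _ _) (h _ xT).
Qed.

(** * Flats, closures and coatoms *)

Definition flat S := [forall x, (rank (x |: S) == rank S) ==> (x \in S)].

Lemma flatP S : reflect (forall x, rank (x |: S) = rank S -> x \in S) (flat S).
Proof.
apply: (iffP forallP) => h x; first by move=> e; have := h x; rewrite e eqxx.
by apply/implyP => /eqP/h.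
Qed.

Definition cl S := [set x | rank (x |: S) == rank S].

Lemma sub_cl S : S \subset cl S.
Proof. by apply/subsetP=> x xS; rewrite inE (setUidPr _) // sub1set. Qed.

Lemma rank_cl S : rank (cl S) = rank S.
Proof.
rewrite -{1}(setUidPr (sub_cl S)); apply: rank_span => z.
by rewrite inE => /eqP.
Qed.

Lemma flat_cl S : flat (cl S).
Proof.
apply/flatP=> x; rewrite rank_cl => e; rewrite inE eqn_leq (rankS (subsetUr _ _)) andbT.
by rewrite -[X in (_ <= X)%N]e rankS // setUS ?sub_cl.
Qed.

Lemma cl_sub S T : flat T -> S \subset T -> cl S \subset T.
Proof.
move=> /flatP fT ST; apply/subsetP=> x; rewrite inE => /eqP e.
by apply: fT; apply: rankU1_sub ST e.
Qed.

Lemma flat_setT : flat setT.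
Proof. by apply/flatP=> x; rewrite inE. Qed.

Lemma flat_eq S T : flat S -> S \subset T -> (rank T <= rank S)%N -> S = T.
Proof.
move=> /flatP fS ST rTS; apply/eqP; rewrite eqEsubset ST; apply/subsetP=> x xT.
apply: fS; apply/eqP; rewrite eqn_leq (rankS (subsetUr _ _)) andbT.
by apply: leq_trans rTS; apply: rankS; rewrite subUset sub1set xT.
Qed.

Definition coatom T H := [&& flat H, H \subset T & (rank H).+1 == rank T].

(** A largest set between [S] and [T] of rank below that of [T] reaches full rank with any further
    element of [T], so it is a flat of corank one. *)
Lemma coatom_extend S T : flat T -> S \subset T -> (rank S < rank T)%N ->
  exists2 H, coatom T H & S \subset H.
Proof.
move=> /flatP fT ST lt.
pose P (X : {set 'I_n}) := [&& S \subset X, X \subset T & (rank X < rank T)%N].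
have PS : P S by rewrite /P subxx ST.
have [X /and3P[SX XT rX] maxX] := @arg_maxnP _ S P (fun X => #|X|) PS.
exists X => //.
have big x : x \in T -> x \notin X -> (rank T <= rank (x |: X))%N.
  move=> xT xX; rewrite leqNgt; apply/negP=> lt'.
  have : P (x |: X).
    by rewrite /P lt' andbT (subset_trans SX (subsetUr _ _)) subUset sub1set xT XT.
  by move/maxX => /=; rewrite cardsU1 xX add1n ltnn.
rewrite /coatom XT /=; apply/andP; split.
  apply/flatP=> x e; apply: contraT => xX.
  have xT : x \in T by apply: fT; apply: rankU1_sub XT e.
  by have := big x xT xX; rewrite e leqNgt rX.
have /subsetPn[x xT xX] : ~~ (T \subset X).
  by apply/negP=> /rankS; rewrite leqNgt rX.
by rewrite eqn_leq rX (leq_trans (big x xT xX)) // rankU1.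
Qed.

Lemma coatom_join T H G x : flat T -> coatom T H -> coatom H G -> x \in T -> x \notin H ->
  coatom T (cl (x |: G)).
Proof.
move=> fT /and3P[fH HT /eqP rH] /and3P[fG GH /eqP rG] xT xH.
have xG : x \notin G by apply: contra xH; apply: (subsetP GH).
rewrite /coatom flat_cl cl_sub ?rank_cl //; last first.
  by rewrite subUset sub1set xT (subset_trans GH HT).
rewrite -rH -rG !eqSS eqn_leq rankU1 ltn_neqAle (rankS (subsetUr _ _)) andbT.
by apply/negP=> /eqP e; rewrite (flatP _ fG x (esym e)) in xG.
Qed.

Lemma rank_setT F : F \in B -> rank setT = #|F|.
Proof.
move=> FB; apply/eqP; rewrite eqn_leq rank_indep ?subsetT ?andbT //; last first.
  by apply/existsP; exists F; rewrite FB subxx.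
have [I [/existsP[F' /andP[F'B IF']] _ <-]] := rank_witness setT.
by rewrite (card_basis FB F'B) subset_leq_card.
Qed.

Lemma indep_full I : indep I -> #|I| = rank setT -> I \in B.
Proof.
case/existsP=> F /andP[FB IF]; rewrite (rank_setT FB) => e.
by have/eqP -> : I == F by rewrite eqEcard IF e leqnn.
Qed.

End Matroid.

(** * Multigraded resolutions and mapping cones *)

Lemma ord_unique m (i j : 'I_m) : m = 1%N -> i = j.
Proof.
by move=> m1; apply: val_inj; case: i j; rewrite m1 => -[|?] // ? [[|?]].
Qed.

(** Dependent choice for a family of types. It builds chain maps degree by degree, with [Q] the
    induction invariant and [S] the commutation with the differentials. *)
Lemma dependent_recursion (T : nat -> Type) (Q : forall i, T i -> Prop)
    (S : forall i, T i -> T i.+1 -> Prop) (x0 : T 0) :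
  Q 0 x0 -> (forall i x, Q i x -> exists2 y, Q i.+1 y & S i x y) ->
  exists f : forall i, T i, [/\ f 0 = x0, forall i, Q i (f i) & forall i, S i (f i) (f i.+1)].
Proof.
move=> Q0 step.
have next i (x : {x | Q i x}) : {y : {y | Q i.+1 y} | S i (proj1_sig x) (proj1_sig y)}.
  apply: constructive_indefinite_description; case: x => x Qx /=.
  by have [y Qy Sy] := step i x Qx; exists (exist _ y Qy).
pose f := fix f i : {x | Q i x} :=
  if i is j.+1 then proj1_sig (next j (f j)) else exist _ x0 Q0.
exists (fun i => proj1_sig (f i)); split=> // i; first exact: (proj2_sig (f i)).
exact: proj2_sig (next i (f i)).
Qed.

Section Homological.
Local Open Scope ring_scope.
Variables (K : fieldType) (n : nat).
Local Notation mon := ('X_{1..n}).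
Local Notation R := {mpoly K[n]}.

(** * Multihomogeneous entries, lifting and comparison maps *)

Definition hom_part (a d : mon) (p : R) : R :=
  if lem a d then p@_(d - a)%MM *: 'X_[d - a] else 0.

Lemma hom_part_sum a d (I : finType) (f : I -> R) :
  hom_part a d (\sum_i f i) = \sum_i hom_part a d (f i).
Proof.
rewrite /hom_part; case: ifP => _; last by rewrite big1.
by rewrite raddf_sum scaler_suml.
Qed.

Lemma hom_part_id a d (p : R) : hom_entry p a d -> hom_part a d p = p.
Proof.
case=> k [-> h]; rewrite /hom_part mcoeffZ mcoeffX eqxx mulr1.
case: ifP => // ad; have [->|/h] := eqVneq k 0; first by rewrite scale0r.
by rewrite ad.
Qed.

Lemma hom_part_hom a d (p : R) : hom_entry (hom_part a d p) a d.
Proof.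
rewrite /hom_part; case: ifP => ad; first by exists p@_(d - a).
by exists 0; split; rewrite ?scale0r // eqxx.
Qed.

Lemma hom_part_mul a b d (p q : R) : hom_entry p a b ->
  hom_part a d (p * q) = p * hom_part b d q.
Proof.
case=> k [-> h]; have [->|k0] := eqVneq k 0.
  by rewrite scale0r !mul0r /hom_part mcoeff0 scale0r if_same.
have {h} ab := h k0.
rewrite -scalerAl /hom_part; have [bd|nbd] := boolP (lem b d).
  have ad : lem a d by apply: (lepm_trans ab bd).
  have e : (d - a = (b - a) + (d - b))%MM.
    apply/mnmP=> i; move/mnm_lepP: ab => /(_ i) ai; move/mnm_lepP: bd => /(_ i) di.
    by rewrite !(mnmE, mnmBE, mnmDE) addnC addnBA // subnK.
  by rewrite ad mcoeffZ e [_ * q]mulrC mcoeffMX mpolyXD -scalerAr -scalerAl !scalerA mulrC.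
(* When [b] does not divide [d], no monomial of [q] times x^(b-a) can be x^(d-a), so the coefficient
   vanishes. *)
rewrite mulr0; case: ifP => // ad.
rewrite mcoeffZ [_ * q]mulrC.
suff -> : (q * 'X_[b - a])@_(d - a) = 0 by rewrite mulr0 scale0r.
apply: memN_msupp_eq0; rewrite (perm_mem (msuppMX _ _)).
apply/mapP=> -[m _ e]; case/negP: nbd; apply/mnm_lepP=> i.
have /mnmP/(_ i) := e; move/mnm_lepP: ab => /(_ i); move/mnm_lepP: ad => /(_ i).
rewrite mnmDE !mnmBE; lia.
Qed.

Section Complex.
Variable F : cx K n.
Hypothesis F_hom : forall i a b, hom_entry (dm F i a b) (deg F i a) (deg F i.+1 b).

Definition hom_mx (p q : nat) (a : 'I_p -> mon) (b : 'I_q -> mon) (A : 'M[R]_(p, q)) :=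
  forall i j, hom_entry (A i j) (a i) (b j).

(** Lift column by column, then replace each entry by its multihomogeneous part; by [hom_part_mul]
    the result still lifts [A]. *)
Lemma hom_lift i p (d : 'I_p -> mon) (A : 'M[R]_(rk F i, p)) :
  hom_mx (deg F i) d A ->
  (forall b, exists y : 'cV[R]_(rk F i.+1), dm F i *m y = col b A) ->
  exists2 Y, hom_mx (deg F i.+1) d Y & dm F i *m Y = A.
Proof.
move=> Ahom imA.
pose y b := proj1_sig (constructive_indefinite_description _ (imA b)).
have yE b : dm F i *m y b = col b A by exact: (proj2_sig (constructive_indefinite_description _ (imA b))).
exists (\matrix_(k, b) hom_part (deg F i.+1 k) (d b) (y b k ord0)).
  by move=> k b; rewrite mxE; apply: hom_part_hom.
apply/matrixP=> a b; rewrite mxE -[RHS](hom_part_id (Ahom a b)).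
have /matrixP/(_ a ord0) := yE b; rewrite !mxE => <-.
rewrite hom_part_sum; apply: eq_bigr => k _.
by rewrite mxE (hom_part_mul _ _ (F_hom a k)).
Qed.
End Complex.

Lemma hom_entry_mul (p q : R) a b d :
  hom_entry p a b -> hom_entry q b d -> hom_entry (p * q) a d.
Proof.
by move=> hp hq; rewrite -(hom_part_id hq) -(hom_part_mul _ _ hp); apply: hom_part_hom.
Qed.

Lemma hom_entry_sum (I : finType) (f : I -> R) a d :
  (forall i, hom_entry (f i) a d) -> hom_entry (\sum_i f i) a d.
Proof.
move=> h; under eq_bigr do rewrite -(hom_part_id (h _)).
by rewrite -hom_part_sum; apply: hom_part_hom.
Qed.

Lemma hom_mx_mul p q r (a : 'I_p -> mon) (b : 'I_q -> mon) (d : 'I_r -> mon) A A' :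
  hom_mx a b A -> hom_mx b d A' -> hom_mx a d (A *m A').
Proof.
move=> hA hA' i j; rewrite mxE; apply: hom_entry_sum => k.
exact: hom_entry_mul (hA _ _) (hA' _ _).
Qed.

Lemma hom_entry_shift (p : R) a b N : hom_entry p a b -> hom_entry p (a + N)%MM (b + N)%MM.
Proof.
case=> k [-> h]; exists k; split.
  by congr (_ *: 'X_[_]); apply/mnmP=> i; rewrite !(mnmBE, mnmDE) subnDr.
move=> /h /mnm_lepP ab; apply/mnm_lepP=> i.
by rewrite !mnmDE leq_add2r.
Qed.

Lemma in_image_col (G : cx K n) (j0 : 'I_(rk G 0)) (x : 'cV[R]_(rk G 0)) (p : R) :
  rk G 0 = 1%N -> x j0 ord0 = p ->
  (exists y : 'cV[R]_(rk G 1), forall j, (dm G 0 *m y) j ord0 = p) ->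
  exists y : 'cV[R]_(rk G 1), dm G 0 *m y = x.
Proof.
move=> r1 xp [y hy]; exists y; apply/colP=> j; rewrite hy -xp; congr (x _ _).
exact: ord_unique.
Qed.

Lemma in_mideal_sum (I : mideal n) (T : finType) (f : T -> R) :
  (forall t, in_mideal I (f t)) -> in_mideal I (\sum_t f t).
Proof.
move=> h m /msupp_sum_le /flattenP[s /mapP[t _ ->]]; exact: h.
Qed.

Lemma in_mideal_mulX (I : mideal n) (N : mon) (p : R) :
  in_mideal I ('X_[N] * p) <-> in_mideal (fun m => I (m + N)%MM) p.
Proof.
rewrite mulrC; split=> h m.
  by move=> mp; apply: h; rewrite (perm_mem (msuppMX _ _)) addmC map_f.
by rewrite (perm_mem (msuppMX _ _)) => /mapP[m' m'p ->]; rewrite addmC; apply: h.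
Qed.

Lemma res_dm0 (I : mideal n) (F : cx K n) : is_res I F ->
  forall a b, in_mideal I (dm F 0 a b).
Proof.
move=> [[r1 _] _ _ _ im] a b; apply/im.
have [y hy] : exists y : 'cV[R]_(rk F 1), dm F 0 *m y = col b (dm F 0).
  by exists (delta_mx b ord0); rewrite -colE.
exists y => j; rewrite hy mxE; congr (dm F 0 _ _).
exact: ord_unique.
Qed.

Lemma comparison_exists (C I : mideal n) (F G : cx K n) (N : mon) :
  is_res C F -> is_res I G -> (forall m, C m -> I (m + N)%MM) ->
  exists phi : forall i, 'M[R]_(rk G i, rk F i), @is_comparison K n F G N phi.
Proof.
move=> resF resG CI; have F0 := res_dm0 resF.
case: resF => -[rF dF] hF ddF _ _; case: resG => -[rG dG] hG ddG exG imG.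
(* The second clause of the invariant says that the next lift exists. It comes from [CI] in degree
   zero and from exactness of [G] afterwards. *)
pose Q i (A : 'M[R]_(rk G i, rk F i)) :=
  hom_mx (deg G i) (fun b => deg F i b + N)%MM A /\
  forall b, exists y : 'cV[R]_(rk G i.+1), dm G i *m y = col b (A *m dm F i).
pose S i (A : 'M[R]_(rk G i, rk F i)) (A' : 'M[R]_(rk G i.+1, rk F i.+1)) :=
  dm G i *m A' = A *m dm F i.
have [|i A [Ahom Aim]|phi [phi0 hphi Sphi]] :=
  @dependent_recursion (fun i => 'M[R]_(rk G i, rk F i)) Q S (const_mx 'X_[N]).
- have hA a b : hom_entry 'X_[N] (deg G 0 a) (deg F 0 b + N)%MM.
    exists 1; rewrite scale1r dG dF add0m subm0; split=> // _.
    by apply/mnm_lepP=> i; rewrite mnm0E.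
  split=> [a b|b]; first by rewrite mxE.
  have j0 : 'I_(rk G 0) by rewrite rG; exact: ord0.
  apply: (in_image_col (j0 := j0) (p := (const_mx 'X_[N] *m dm F 0) j0 b)) => //.
    by rewrite mxE.
  apply/imG; rewrite mxE; apply: in_mideal_sum => k; rewrite mxE in_mideal_mulX.
  by move=> m /F0 /CI.
- have [Y Yhom YE] := hom_lift hG (hom_mx_mul Ahom (fun k b => hom_entry_shift N (hF i k b))) Aim.
  exists Y => //; split=> // b; apply: exG.
  by rewrite colE !mulmxA YE -(mulmxA A) ddF mulmx0 mul0mx.
exists phi; split=> [a b|i|//]; first by rewrite phi0 mxE.
by have [] := hphi i.
Qed.

Lemma is_res_ext (I I' : mideal n) (F : cx K n) :
  (forall m, I m <-> I' m) -> is_res I F -> is_res I' F.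
Proof.
move=> II' [? ? ? ? im]; split=> // p; rewrite -im.
by split=> h m /h /II'.
Qed.

(** * The mapping cone of a comparison map *)

Section Cone.
Variables (I C I' : mideal n) (G F : cx K n) (N : mon).
Variable phi : forall i, 'M[R]_(rk G i, rk F i).
Hypotheses (resG : is_res I G) (resF : is_res C F) (cmp : is_comparison N phi).
Hypothesis colonE : forall m, C m <-> I (m + N)%MM.
Hypothesis sumE : forall m, I' m <-> I m \/ mdivides N m.
Let co := @cone K n G F N phi.

Lemma cone_hom i a b : hom_entry (dm co i a b) (deg co i a) (deg co i.+1 b).
Proof.
have [_ hG _ _ _] := resG; have [_ hF _ _ _] := resF; have [_ hphi _] := cmp.
have hom0 a' b' : hom_entry (0 : R) a' b' by exists 0; rewrite scale0r eqxx.
rewrite /= /block_mx !mxE; case: splitP => a' _; rewrite !mxE; case: splitP => b' _.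
- exact: hG.
- exact: hphi.
- by rewrite mxE.
- rewrite mxE; case: i a b a' b' => [|i] a b a' b' /=; first by case: a'.
  have [k [-> h]] := hom_entry_shift N (hF i a' b').
  by exists (- k); rewrite scaleNr oppr_eq0.
Qed.

Lemma cone_dd i : dm co i *m dm co i.+1 = 0.
Proof.
have [_ _ ddG _ _] := resG; have [_ _ ddF _ _] := resF; have [_ _ cphi] := cmp.
rewrite /= mulmx_block ddG !(mul0mx, mulmx0, addr0, add0r) cphi mulmxN subrr.
suff -> : - dS F i *m - dm F i = 0 by rewrite block_mx0.
rewrite mulNmx mulmxN opprK; case: i => [|i] /=; last exact: ddF.
by rewrite mul0mx.
Qed.

(** For a cycle (g,f), first f is a boundary dy in [F]; then g + phi(y) is a cycle of [G], hence a
    boundary. *)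
Lemma cone_exact i (x : 'cV[R]_(rk co i.+1)) : dm co i *m x = 0 ->
  exists y : 'cV[R]_(rk co i.+2), dm co i.+1 *m y = x.
Proof.
have [[rG dG] hG ddG exG imG] := resG; have [[rF dF] hF ddF exF imF] := resF.
have [phi0 hphi cphi] := cmp.
rewrite -(vsubmxK x) [dm co i]/= mul_block_col.
set g := usubmx x; set f := dsubmx x.
move=> /eqP; rewrite col_mx_eq0 => /andP[/eqP gf /eqP df].
have [y yf] : exists y : 'cV[R]_(rk F i.+1), dm F i *m y = f.
  clearbody g f; clear x; case: i g f gf df => [|i] g f gf df; last first.
    by apply: exF; apply/eqP; rewrite -oppr_eq0 -mulNmx; apply/eqP; rewrite -[RHS]df mul0mx add0r.
  (* In degree zero [F] imposes no cycle condition on [f]. Instead [gf] puts the product of x^N and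
     [f] in [I], so [f] lies in the colon ideal [C]. *)
  have j0 : 'I_(rk F 0) by rewrite rF; exact: ord0.
  apply: (in_image_col (j0 := j0) (p := f j0 ord0)) => //; apply/imF => m fm.
  apply/colonE; rewrite addmC.
  have k0 : 'I_(rk G 0) by rewrite rG; exact: ord0.
  have e : 'X_[N] * f j0 ord0 = (dm G 0 *m - g) k0 ord0.
    have : phi 0 *m f = dm G 0 *m - g by rewrite mulmxN; apply/esym/eqP; rewrite eqr_oppLR -addr_eq0 gf.
    move/matrixP/(_ k0 ord0) => <-; rewrite mxE (bigD1 j0) //= phi0 big1 ?addr0 // => k.
    case/negP; exact/eqP/ord_unique.
  have : in_mideal I ('X_[N] * f j0 ord0).
    apply/imG; exists (- g) => j; rewrite e; congr ((_ *m _) _ _).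
    exact: ord_unique.
  by rewrite in_mideal_mulX => /(_ m fm); rewrite addmC.
have [z zg] : exists z : 'cV[R]_(rk G i.+2), dm G i.+1 *m z = g + phi i.+1 *m y.
  by apply: exG; rewrite mulmxDr mulmxA cphi -mulmxA yf gf.
(* The sign of [y] cancels that of the shifted differential and removes the term phi(y). *)
exists (col_mx z (- y)).
by rewrite [dm co _]/= mul_block_col zg !mulmxN addrK mul0mx add0r mulNmx opprK yf.
Qed.

(** A monomial of [I'] lies in [I], and is reached through [dm G 0], or is a multiple of x^N, and is
    reached through [phi 0]. *)
Lemma cone_image (p : R) : in_mideal I' p <->
  exists y : 'cV[R]_(rk co 1), forall j, (dm co 0 *m y) j ord0 = p.
Proof.
have [[rG dG] hG ddG exG imG] := resG; have [[rF dF] hF ddF exF imF] := resF.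
have [phi0 hphi cphi] := cmp.
have j0 : 'I_(rk F 0) by rewrite rF; exact: ord0.
have phiE (f : 'cV[R]_(rk F 0)) k : (phi 0 *m f) k ord0 = 'X_[N] * f j0 ord0.
  rewrite mxE (bigD1 j0) //= phi0 big1 ?addr0 // => i.
  case/negP; exact/eqP/ord_unique.
have dmE g f (j : 'I_(rk co 0)) : exists k,
    (dm co 0 *m (col_mx g f : 'cV[R]_(rk co 1))) j ord0 =
    (dm G 0 *m g) k ord0 + 'X_[N] * f j0 ord0.
  rewrite [dm co 0]/= mul_block_col mxE; case: splitP => [k _|[]//].
  by exists k; rewrite mxE phiE.
split=> [pI'|].
  rewrite (mpolyE p) big_seq.
  apply: (big_ind (fun q => exists y : 'cV[R]_(rk co 1), forall j, (dm co 0 *m y) j ord0 = q)).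
  - by exists 0 => j; rewrite mulmx0 mxE.
  - by move=> q q' [y hy] [y' hy']; exists (y + y') => j; rewrite mulmxDr mxE hy hy'.
  - move=> m /pI' /sumE[mI|mN].
      have /imG[g hg] : in_mideal I (p@_m *: 'X_[m]).
        by move=> m' /msuppZ_le; rewrite msuppX inE => /eqP->.
      exists (col_mx g 0) => j; have [k ->] := dmE g 0 j.
      by rewrite hg mxE mulr0 addr0.
    exists (col_mx 0 (const_mx (p@_m *: 'X_[m - N]))) => j; have [k ->] := dmE 0 (const_mx (p@_m *: 'X_[m - N])) j.
    rewrite mulmx0 !mxE add0r -scalerAr -mpolyXD; congr (_ *: 'X_[_]).
    by apply/mnmP=> i; rewrite mnmDE mnmBE subnKC.
case=> y hy; pose g : 'cV[R]_(rk G 1) := usubmx (y : 'cV_(rk G 1 + rk F 0)).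
pose f : 'cV[R]_(rk F 0) := dsubmx (y : 'cV_(rk G 1 + rk F 0)).
have j : 'I_(rk co 0) by rewrite /= addn0 rG; exact: ord0.
have [k] := dmE g f j; rewrite (_ : col_mx g f = y) ?vsubmxK // hy => ->.
move=> m /msuppD_le; rewrite mem_cat => /orP[mg|mf]; apply/sumE.
  left; have /imG : exists y' : 'cV[R]_(rk G 1), forall j, (dm G 0 *m y') j ord0 = (dm G 0 *m g) k ord0.
    exists g => j'; congr ((_ *m _) _ _).
    exact: ord_unique.
  by apply.
right; move: mf; rewrite mulrC (perm_mem (msuppMX _ _)) => /mapP[m' _ ->] i.
by rewrite mnmDE leq_addr.
Qed.

Lemma cone_is_res : is_res I' co.
Proof.
split; [| exact: cone_hom | exact: cone_dd | exact: cone_exact | exact: cone_image].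
have [[rG dG] _ _ _ _] := resG; split=> [|j]; first by rewrite /= addn0.
by rewrite /=; case: splitP => [k _|[]//].
Qed.

End Cone.

Lemma cone_deg (G F : cx K n) (N : mon) (phi : forall i, 'M[R]_(rk G i, rk F i)) i j :
  (exists a, deg (cone N phi) i j = deg G i a) \/
  (exists k (b : 'I_(rk F k)), i = k.+1 /\ deg (cone N phi) i j = (deg F k b + N)%MM).
Proof.
rewrite /=; case: splitP => [a _|b _]; first by left; exists a.
by right; case: i j b => [|i] j b; [case: b | exists i, b].
Qed.

(* The composite F -> G -> F of comparison maps is homotopic to the identity,
   and by minimality a homotopy has zero constant coefficients, so every
   diagonal entry of the composite has constant coefficient 1. *)
Lemma min_res_degs (I : mideal n) (F G : cx K n) :
  is_min_res I F -> is_res I G -> forall i j, exists k, deg F i j = deg G i k.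
Proof.
move=> [resF minF] resG.
have I0 m : I m <-> I (m + 0)%MM by rewrite addm0.
have [phi [phi0 hphi cphi]] := comparison_exists resF resG (fun m => proj1 (I0 m)).
have [psi [psi0 _ cpsi]] := comparison_exists resG resF (fun m => proj1 (I0 m)).
case: resF => -[rF dF] hF ddF exF imF; case: resG => -[rG dG] hG ddG exG imG.
pose chi i : 'M[R]_(rk F i) := psi i *m phi i - 1%:M.
have cchi i : dm F i *m chi i.+1 = chi i *m dm F i.
  by rewrite mulmxBr mulmxBl mulmxA cpsi -!mulmxA cphi mulmx1 mul1mx.
have k0 : 'I_(rk G 0) by rewrite rG; exact: ord0.
have chi0 : chi 0%N = 0.
  apply/matrixP=> a b; rewrite !mxE (bigD1 k0) //= phi0 psi0 big1 ?addr0; last first.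
    move=> k; case/negP; exact/eqP/ord_unique.
  rewrite mpolyX0 mulr1 (_ : a == b) ?subrr //; exact/eqP/ord_unique.
have lift i (X : 'M[R]_(rk F i.+1)) : dm F i *m X = 0 ->
    exists s : 'M[R]_(rk F i.+2, rk F i.+1), X = dm F i.+1 *m s.
  move=> dX; have ex b : exists y : 'cV[R]_(rk F i.+2), dm F i.+1 *m y = col b X.
    by apply: exF; rewrite colE mulmxA dX mul0mx.
  exists (\matrix_(k, b) proj1_sig (constructive_indefinite_description _ (ex b)) k ord0).
  apply/matrixP=> a b; have := proj2_sig (constructive_indefinite_description _ (ex b)).
  by move/matrixP/(_ a ord0); rewrite !mxE => <-; apply: eq_bigr => k _; rewrite mxE.
(* The first equation drives the induction: it makes [chi i.+1 - s *m dm F i] a cycle, hence a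
   boundary. *)
have htpy i : exists s : 'M[R]_(rk F i.+1, rk F i),
    dm F i *m s *m dm F i = chi i *m dm F i /\
    exists t : 'M[R]_(rk F i.+2, rk F i.+1), chi i.+1 = dm F i.+1 *m t + s *m dm F i.
  have next (s : 'M[R]_(rk F i.+1, rk F i)) : dm F i *m s *m dm F i = chi i *m dm F i ->
      exists t : 'M[R]_(rk F i.+2, rk F i.+1), chi i.+1 = dm F i.+1 *m t + s *m dm F i.
    move=> hs; have [|t ht] := lift i (chi i.+1 - s *m dm F i).
      by rewrite mulmxBr cchi mulmxA hs subrr.
    by exists t; rewrite -ht subrK.
  suff [s hs] : exists s : 'M[R]_(rk F i.+1, rk F i), dm F i *m s *m dm F i = chi i *m dm F i.
    by exists s; split=> //; apply: next.
  elim: i {next} => [|i [s hs]]; first by exists 0; rewrite mulmx0 chi0 !mul0mx.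
  have [|t ht] := lift i (chi i.+1 - s *m dm F i).
    by rewrite mulmxBr cchi mulmxA hs subrr.
  by exists t; rewrite -ht mulmxBl -mulmxA ddF mulmx0 subr0.
have chi_const i a b : (chi i a b)@_0%MM = 0.
  case: i a b => [|i] a b; first by rewrite chi0 mxE mcoeff0.
  have [s [_ [t ->]]] := htpy i.
  rewrite !mxE mcoeffD !raddf_sum !big1 ?addr0 // => k _ /=.
    by rewrite (rmorphM (mcoeff 0%MM)) /= minF mulr0.
  by rewrite (rmorphM (mcoeff 0%MM)) /= minF mul0r.
(* Some [phi i k j] has a nonzero constant coefficient; being multihomogeneous, it forces the two
   degrees to agree. *)
move=> i j; have := chi_const i j j.
rewrite !mxE eqxx mcoeffB mcoeff1 eqxx raddf_sum => /eqP; rewrite subr_eq0 => /eqP sum1.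
have [k nz] : exists k, (psi i j k * phi i k j)@_0%MM != 0.
  apply/existsP; apply: contraT; rewrite negb_exists => /forallP h.
  exfalso; have /eqP[] := oner_neq0 K; rewrite -[LHS]sum1; apply: big1 => k _.
  by apply/eqP; have := h k; rewrite negbK.
exists k; have [c [e h]] := hphi i k j; move: nz.
rewrite (rmorphM (mcoeff 0%MM)) /= e mcoeffZ mcoeffX addm0 in h *.
have [->|c0] := eqVneq c 0; first by rewrite mul0r mulr0 eqxx.
have /mnm_lepP le := h c0.
have [/mnmP d _|ne] := eqVneq (deg F i j - deg G i k)%MM 0%MM; last first.
  by rewrite mulr0n !mulr0 eqxx.
apply/mnmP=> l; move: (d l) (le l); rewrite mnmBE mnm0E; lia.
Qed.

(** * Resolutions of R and of R/(N) *)

Definition unit_cx : cx K n :=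
  @Cx K n (fun i => (i == 0)%N : nat) (fun _ _ => 0%MM) (fun _ => 0).

Lemma unit_cx_is_res : is_res (fun _ => False) unit_cx.
Proof.
split=> //=.
- by move=> i a b; exists 0; rewrite mxE scale0r eqxx.
- by move=> i; rewrite mul0mx.
- by move=> i x _; exists 0; apply/colP=> -[].
- move=> p; split=> [h|[y hy]].
    exists 0 => j; rewrite mulmx0 mxE; apply/esym/msuppnil0.
    by move: h; rewrite /in_mideal; case: (msupp p) => // m s h; case: (h m); rewrite inE eqxx.
  by rewrite -(hy ord0) mul0mx mxE => m; rewrite msupp0.
Qed.

Lemma principal_is_res (N : mon) (F : cx K n) :
  rk F 0 = 1%N -> rk F 1 = 1%N -> (forall i, (2 <= i)%N -> rk F i = 0%N) ->
  (forall j, deg F 0 j = 0%MM) -> (forall j, deg F 1 j = N) ->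
  (forall a b, dm F 0 a b = 'X_[N]) -> is_res (mdivides N) F.
Proof.
move=> r0 r1 r2 d0 d1 m0.
have noI i (j : 'I_(rk F i.+2)) : False by case: j; rewrite r2.
have j0 : 'I_(rk F 0) by rewrite r0; exact: ord0.
have k0 : 'I_(rk F 1) by rewrite r1; exact: ord0.
have uk (k : 'I_(rk F 1)) : k = k0.
  exact: ord_unique.
have mulE (y : 'cV[R]_(rk F 1)) j : (dm F 0 *m y) j ord0 = 'X_[N] * y k0 ord0.
  by rewrite mxE (bigD1 k0) //= m0 big1 ?addr0 // => k; rewrite (uk k) eqxx.
split=> //.
- move=> [|i] a b; last by case: (noI i b).
  by rewrite m0 d0 d1; exists 1; rewrite scale1r subm0; split=> // _; apply/mnm_lepP=> i; rewrite mnm0E.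
- by move=> i; apply/matrixP=> a b; case: (noI i b).
- move=> [|i] x; last by move=> _; exists 0; apply/colP=> j; case: (noI i j).
  have X0 : 'X_[N] != 0 :> R by rewrite -msupp_eq0 msuppX.
  move=> /matrixP/(_ j0 ord0); rewrite mulE mxE => /eqP.
  rewrite mulf_eq0 (negbTE X0) /= => /eqP x0; exists 0; apply/colP=> k.
  by rewrite mulmx0 mxE (uk k) x0.
- move=> p; split=> [h|[y hy]].
    have [q ->] : exists q, p = 'X_[N] * q.
      rewrite (mpolyE p) big_seq.
      apply: (big_ind (fun p => exists q, p = 'X_[N] * q)).
      - by exists 0; rewrite mulr0.
      - by move=> _ _ [q ->] [q' ->]; exists (q + q'); rewrite mulrDr.
      - move=> m /h mN; exists (p@_m *: 'X_[m - N]).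
        rewrite -scalerAr -mpolyXD; congr (_ *: 'X_[_]).
        by apply/mnmP=> i; rewrite mnmDE mnmBE subnKC.
    by exists (const_mx q) => j; rewrite mulE mxE.
  rewrite -(hy j0) mulE mulrC => m; rewrite (perm_mem (msuppMX _ _)) => /mapP[m' _ ->] i.
  by rewrite mnmDE leq_addr.
Qed.

End Homological.

(** * Ideals of intervals in the lattice of flats *)

Section SetMonomials.
Variable n : nat.
Implicit Types (S T : {set 'I_n}) (m : 'X_{1..n}).

Definition mset S : 'X_{1..n} := [multinom (i \in S : nat) | i < n].

Definition msup m : {set 'I_n} := [set i | 0 < m i].

Lemma msetE S i : mset S i = (i \in S).
Proof. exact: mnmE. Qed.

Lemma msup_mset S : msup (mset S) = S.
Proof. by apply/setP=> i; rewrite inE msetE; case: (i \in S). Qed.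

Lemma mset_inj : injective mset.
Proof. by move=> S T e; rewrite -(msup_mset S) e msup_mset. Qed.

Lemma mdivides_mset S m : mdivides (mset S) m <-> S \subset msup m.
Proof.
split=> [h|/subsetP h i].
  by apply/subsetP=> i iS; have := h i; rewrite inE msetE iS.
by rewrite msetE; case: (boolP (i \in S)) => // /h; rewrite inE.
Qed.

Lemma msqfree_mset m : msqfree m -> m = mset (msup m).
Proof.
by move=> h; apply/mnmP=> i; rewrite msetE inE; have := h i; case: (m i) => [|[]].
Qed.

Lemma msetD S T (U : {set 'I_n}) : U \subset T -> T \subset S ->
  (mset (T :\: U) + mset (S :\: T))%MM = mset (S :\: U).
Proof.
move=> /subsetP UT /subsetP TS; apply/mnmP=> i; rewrite mnmDE !msetE !inE.
have /implyP := UT i; have /implyP := TS i.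
by case: (i \in U) (i \in T) (i \in S) => -[] [].
Qed.

Lemma mdivides_anti m m' : mdivides m m' -> mdivides m' m -> m = m'.
Proof. by move=> h h'; apply/mnmP=> i; apply/eqP; rewrite eqn_leq h h'. Qed.

End SetMonomials.

Section Interval.
Variables (n : nat) (B : {set {set 'I_n}}).
Hypothesis matB : is_matroid B.
Implicit Types (S T A F I H : {set 'I_n}) (m : 'X_{1..n}).
Local Notation rank := (rank B).
Local Notation flat := (flat B).
Local Notation coatom := (coatom B).

(** The ideal I(A,T). For [T = setT] and [A] independent it is the cover ideal of the contraction by
    [A]. *)
Definition interval_ideal A T : mideal n :=
  fun m => exists H, [/\ coatom T H, A \subset H & mdivides (mset (T :\: H)) m].

(** Distinct coatoms meet in rank below that of [H], so [H :&: H'] lies in a coatom G of [H]. Inside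
    [H], the complement of G is in the complement of [H'], so x^(H-G) divides [m]. *)
Lemma interval_of_colon T H H' A m :
  coatom T H -> coatom T H' -> H' <> H -> A \subset H -> A \subset H' ->
  mdivides (mset (T :\: H')) (m + mset (T :\: H))%MM -> interval_ideal A H m.
Proof.
move=> /and3P[fH HT /eqP rH] /and3P[fH' H'T /eqP rH'] ne AH AH' dv.
have [||G cG XG] := coatom_extend matB (S := H :&: H') fH; first exact: subsetIl.
  rewrite ltn_neqAle rankS ?subsetIl // andbT; apply/negP=> /eqP e; apply: ne.
  have eq X : flat X -> H :&: H' \subset X -> rank X = rank H -> cl B (H :&: H') = X.
    move=> fX sX rX; apply: (flat_eq matB); [exact: flat_cl|exact: cl_sub|].
    by rewrite rank_cl // e rX.
  rewrite -(eq H') ?subsetIr ?(eq H) ?subsetIl //.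
  by apply/eqP; rewrite -eqSS rH rH'.
exists G; split=> //; first by apply: subset_trans XG; rewrite subsetI AH.
case/and3P: cG => _ GH _ i; have := dv i; rewrite mnmDE !msetE !inE.
have [iH|] /= := boolP (i \in H); last by rewrite andbF.
rewrite (subsetP HT _ iH) addn0; have [iG //|iG] /= := boolP (i \in G).
have [iH'|//] := boolP (i \in H').
by move: iG; rewrite (subsetP XG) // inE iH.
Qed.

(** The witness is the flat spanned by [x] and the given coatom G of [H]. What it misses inside [H]
    is missed by G, and what it misses outside [H] is absorbed by x^(T-H). *)
Lemma colon_of_interval T H A m x :
  flat T -> coatom T H -> x \in T -> x \notin H -> interval_ideal A H m ->
  exists H', [/\ coatom T H', x |: A \subset H' &
                 mdivides (mset (T :\: H')) (m + mset (T :\: H))%MM].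
Proof.
move=> fT cH xT xH [G [cG AG dv]]; exists (cl B (x |: G)); split.
- exact: coatom_join cH cG xT xH.
- by apply: subset_trans (sub_cl _ _); apply: setUS.
move=> i; have := dv i; rewrite mnmDE !msetE !in_setD.
have [iH|iH] /= := boolP (i \in H).
  rewrite andbT addn0; have [iG _|_] /= := boolP (i \in G); last first.
    by apply: leq_trans; case: (_ && _).
  suff -> : i \in cl B (x |: G) by [].
  by apply: (subsetP (sub_cl _ _)); rewrite !inE iG orbT.
by move=> _; apply: leq_trans (leq_addl _ _); case: (_ \in _).
Qed.

(** The colon ideal does not depend on the coatoms [L] already added: those containing [x] already
    give all of I(A,H), and any coatom other than [H] contributes only elements of it. *)
Lemma interval_colonE T H A x (L : {set 'I_n} -> Prop) m :
  flat T -> coatom T H -> A \subset H -> x \in T -> x \notin H ->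
  (forall H', L H' -> coatom T H' /\ A \subset H') -> ~ L H ->
  interval_ideal A H m <->
  (interval_ideal (x |: A) T (m + mset (T :\: H))%MM \/
   exists H', L H' /\ mdivides (mset (T :\: H')) (m + mset (T :\: H))%MM).
Proof.
move=> fT cH AH xT xH hL nL; split.
  by move=> /(colon_of_interval fT cH xT xH)[H' h]; left; exists H'.
case=> [[H' [cH' xAH' dv]]|[H' [LH' dv]]].
  apply: interval_of_colon dv => //; last by apply: subset_trans xAH'; apply: subsetUr.
  by move=> e; move: xAH'; rewrite subUset sub1set e (negbTE xH).
have [cH' AH'] := hL _ LH'.
by apply: interval_of_colon dv => // e; rewrite e in LH'.
Qed.

(* The coatoms containing x generate [interval_ideal (x |: A) T]; the others are
   added one at a time in any order, each colon ideal being [interval_ideal A H]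
   for the added coatom H. *)
Lemma interval_resolution (K : fieldType) T A : flat T -> A \subset T ->
  exists G : cx K n, is_res (interval_ideal A T) G /\
    forall i j, exists H, [/\ flat H, H \subset T, (rank H + i = rank T)%N &
                              deg G i j = mset (T :\: H)].
Proof.
have [r] := ubnP (rank T); elim: r T A => // r IHr T A rT fT.
have [d] := ubnP (rank T - rank A)%N; elim: d A => // d IHd A rA AT.
(* If [A] has full rank in [T], no coatom contains it: the ideal is zero, and the only multidegree
   is 1 = x^(T-T). *)
have [eA|ltA] := leqP (rank T) (rank A).
  exists (unit_cx K n); split.
    apply: is_res_ext (unit_cx_is_res K n) => m; split=> // -[H [cH AH _]].
    case/and3P: cH => _ _ /eqP rH; move: eA; rewrite -rH ltnNge.
    by rewrite rankS.
  move=> [|i] [] // j ltj; exists T; rewrite addn0; split=> //.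
  by rewrite setDv; apply/mnmP=> i; rewrite mnm0E msetE inE.
have [x /andP[xT xA]] : exists x, (x \in T) && (rank (x |: A) != rank A).
  apply/existsP; apply: contraT; rewrite negb_exists => /forallP h.
  have : rank (A :|: T) = rank A.
    apply: rank_span => // z zT; have := h z; rewrite zT /= negbK => /eqP //.
  by move: ltA; rewrite (setUidPr AT) => + e; rewrite e ltnn.
have rxA : (rank A < rank (x |: A))%N.
  by rewrite ltn_neqAle eq_sym xA rankS // subsetUr.
have [||G0 [res0 deg0]] := IHd (x |: A); [by lia|by rewrite subUset sub1set xT|].
pose L := [seq H <- enum [set: {set 'I_n}] | [&& coatom T H, A \subset H & x \notin H]].
have [G [resG degG]] : exists G : cx K n,
  is_res (fun m => interval_ideal (x |: A) T m \/
    exists H, H \in L /\ mdivides (mset (T :\: H)) m) G /\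
    forall i j, exists H, [/\ flat H, H \subset T, (rank H + i = rank T)%N &
                              deg G i j = mset (T :\: H)].
  have : uniq L by rewrite filter_uniq // enum_uniq.
  have : all (fun H => [&& coatom T H, A \subset H & x \notin H]) L by apply: filter_all.
  elim: L => [|H L IHL] /=.
    move=> _ _; exists G0; split=> //; apply: is_res_ext res0 => m.
    by split=> [|[//|[H []]//]]; first by left.
  move=> /andP[/and3P[cH AH xH] allL] /andP[HL uL].
  have [G [resG degG]] := IHL allL uL.
  have /and3P[fH HT /eqP rH] := cH.
  (* The outer induction on the rank resolves the colon ideal I(A,H). *)
  have [|F [resF degF]] := IHr H A _ fH AH; first by rewrite -ltnS rH.
  have hL H' : H' \in L -> coatom T H' /\ A \subset H'.
    by move=> /(allP allL)/and3P[].
  have colon m := interval_colonE (L := fun H => H \in L) m fT cH AH xT xH hL (elimN idP HL).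
  have [phi cmp] := comparison_exists resF resG (fun m => proj1 (colon m)).
  exists (cone (mset (T :\: H)) phi); split.
    apply: (cone_is_res resG resF cmp colon) => m; split.
      case=> [h|[H' []]]; first by left; left.
      rewrite inE => /predU1P[-> h|H'L h]; first by right.
      by left; right; exists H'.
    case=> [[h|[H' [H'L h]]]|h]; [by left|right; exists H'|right; exists H].
      by rewrite inE H'L orbT.
    by rewrite inE eqxx.
  move=> i j; have [[a ->]|[k [b [ik ->]]]] := cone_deg j.
    exact: degG.
  (* The cone raises homological degree by one, as passing from [H] to [T] raises corank by one; the
     shift by x^(T-H) turns x^(H-H') into x^(T-H'). *)
  have [H' [fH' H'H rH' ->]] := degF k b; exists H'; split=> //.
  - exact: subset_trans HT.
  - by rewrite ik -rH -rH' addnS.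
  - exact: msetD.
exists G; split=> //; apply: is_res_ext resG => m; split.
  case=> [[H [cH xAH dv]]|[H [HL dv]]]; exists H; split=> //.
  - by apply: subset_trans xAH; apply: subsetUr.
  - by move: HL; rewrite mem_filter => /andP[/and3P[]].
  - by move: HL; rewrite mem_filter => /andP[/and3P[]].
case=> H [cH AH dv]; have [xH|xH] := boolP (x \in H).
  by left; exists H; rewrite subUset sub1set xH AH.
by right; exists H; rewrite mem_filter cH AH xH mem_enum inE.
Qed.

End Interval.

(** * Minimal generators of cover ideals and of [SF] *)

Section Generators.
Variables (n : nat) (B : {set {set 'I_n}}).
Hypothesis matB : is_matroid B.
Implicit Types (S T A F I H : {set 'I_n}) (m : 'X_{1..n}).
Local Notation rank := (rank B).
Local Notation flat := (flat B).
Local Notation hyperplane := (coatom B setT).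

(** A monomial misses the ideal exactly when the variables outside its support, together with [A],
    contain a basis containing [A]. *)
Lemma cover_contrE A m : indep B A ->
  cover_ideal (contr_bases B A) m <-> (rank (~: msup m :|: A) < rank setT)%N.
Proof.
move=> iA; split=> [h|lt I].
  rewrite ltnNge; apply/negP=> le.
  have [I [iI AI IS cI]] := indep_extend matB iA (subsetUr (~: msup m) A).
  have IB : I \in B.
    by apply: indep_full => //; apply/eqP; rewrite cI eqn_leq le rankS ?subsetT.
  have [|i] := h (I :\: A).
    rewrite inE; apply/andP; split; last by rewrite -{2}(setIidPr AI) setUC setID.
    by rewrite disjoints_subset setDE subsetIr.
  rewrite inE => /andP[iA' iI'] mi.
  by have := subsetP IS _ iI'; rewrite !inE mi (negbTE iA').
rewrite inE => /andP[dis IAB]; apply: NNPP => nh.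
move: lt; rewrite ltnNge => /negP[].
rewrite (rank_setT matB IAB); apply: rank_indep; first by apply/existsP; exists (I :|: A); rewrite IAB subxx.
apply: setSU; apply/subsetP=> i iI; rewrite !inE -leqNgt leqNgt; apply/negP=> mi.
by apply: nh; exists i.
Qed.

(** By [cover_contrE], minimal supports are the complements of maximal sets of non-full rank
    containing [A], which are hyperplanes. *)
Lemma gens_contrE A m : indep B A ->
  mgens (cover_ideal (contr_bases B A)) m <->
  exists H, [/\ hyperplane H, A \subset H & m = mset (setT :\: H)].
Proof.
move=> iA.
have inJ H : hyperplane H -> A \subset H ->
    cover_ideal (contr_bases B A) (mset (setT :\: H)).
  move=> /and3P[_ _ /eqP rH] AH; apply/cover_contrE => //.
  by rewrite msup_mset setTD setCK (setUidPl AH) rH.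
split=> [[mJ minm]|[H [cH AH ->]]].
  have [H cH sH] := coatom_extend matB (flat_setT B) (subsetT _) (proj1 (cover_contrE m iA) mJ).
  have AH : A \subset H by apply: subset_trans sH; apply: subsetUr.
  exists H; split=> //; apply/esym/minm; first exact: inJ.
  rewrite mdivides_mset setTD -setCS setCK; apply: subset_trans sH; exact: subsetUl.
split=> [|m' /(cover_contrE _ iA) rm' dv]; first exact: inJ.
have /and3P[fH _ /eqP rH] := cH.
have sm' : msup m' \subset ~: H.
  by apply/subsetP=> i; rewrite !inE => mi; have := leq_trans mi (dv i); rewrite msetE setTD inE; case: (i \in H).
have e : H = ~: msup m' :|: A.
  apply: (flat_eq matB) fH _ _; last by rewrite -ltnS rH.
  by apply: subset_trans (subsetUl _ _); rewrite -setCS setCK.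
have em : msup m' = ~: H.
  by apply/eqP; rewrite eqEsubset sm' -setCS setCK e subsetUl.
apply: mdivides_anti => //; rewrite mdivides_mset setTD em; exact: subxx.
Qed.

Lemma contr_bases0 : contr_bases B set0 = B.
Proof. by apply/setP=> I; rewrite inE setU0 disjoint_sym disjoints_subset sub0set. Qed.

Lemma indep0 : indep B set0.
Proof. by have [F FB] := basis_exists matB; apply/existsP; exists F; rewrite FB sub0set. Qed.

Lemma GJE m : GJ B m <-> exists2 H, hyperplane H & m = mset (setT :\: H).
Proof.
rewrite /GJ -{1}contr_bases0 gens_contrE ?indep0 //; split=> [[H [? _ ?]]|[H ? ?]]; exists H => //.
by rewrite sub0set.
Qed.

Lemma cover_ideal_gen m : cover_ideal B m -> exists2 N, GJ B N & mdivides N m.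
Proof.
rewrite -{1}contr_bases0 cover_contrE ?indep0 // setU0 => lt.
have [H cH sH] := coatom_extend matB (flat_setT B) (subsetT _) lt.
exists (mset (setT :\: H)); first by apply/GJE; exists H.
by rewrite mdivides_mset setTD -setCS setCK.
Qed.

(** If p_F contains J then [F] contains a basis, for otherwise the product of the variables outside
    [F] is in J but not in p_F. Equal cardinality makes every basis minimal. *)
Lemma minprime_basis F : minprime (cover_ideal B) F <-> F \in B.
Proof.
have sub F' : msub (cover_ideal B) (mprime F') -> exists2 F0, F0 \in B & F0 \subset F'.
  move=> h; apply: NNPP => nh; have [|i iF'] := h (mset (~: F')).
    move=> F0 F0B; have /subsetPn[i iF0 iF'] : ~~ (F0 \subset F') by apply/negP=> s; apply: nh; exists F0.
    by exists i; rewrite // msetE inE iF'.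
  by rewrite msetE inE iF'.
have basis F0 : F0 \in B -> msub (cover_ideal B) (mprime F0) by move=> F0B m; apply.
split=> [[h minF]|FB].
  by have [F0 F0B s] := sub F h; rewrite -(minF F0 (basis _ F0B) s).
split=> [|F' h s]; first exact: basis.
have [F0 F0B s0] := sub F' h; apply/eqP; rewrite eqEcard s /=.
by rewrite (card_basis matB FB F0B) subset_leq_card.
Qed.

Lemma sum_mset F S : \sum_(i in F) mset S i = #|F :&: S|.
Proof.
rewrite -sum1_card [RHS](eq_bigl (fun i => (i \in F) && (i \in S))); last by move=> i; rewrite inE.
by rewrite big_mkcondr; apply: eq_bigr => i _; rewrite msetE; case: (i \in S).
Qed.

(** A basis has at most [rank H] elements in [H], hence at least [h] outside. Conversely, a
    squarefree divisor with this property has a support whose complement contains [H] and has no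
    larger rank, so it equals the flat [H]. *)
Lemma SF_gens H h : flat H -> (rank H + h = rank setT)%N ->
  mgens (SF (cover_ideal B) h) (mset (setT :\: H)).
Proof.
move=> fH rH; split.
  exists (mset (setT :\: H)); split=> //; first by move=> i; rewrite msetE leq_b1.
  move=> F /minprime_basis FB; rewrite /mprime_pow sum_mset setTD -setDE.
  have := cardsID H F; rewrite -(rank_setT matB FB) -rH.
  have : (#|H :&: F| <= rank H)%N by apply: leq_bigmax_cond.
  rewrite (setIC H F); move: #|F :&: H| #|F :\: H| (rank H); lia.
move=> m' [s [sqs sm' ss]] m'H.
have sE := msqfree_mset sqs.
have e : H = ~: msup s.
  apply: (flat_eq matB) fH _ _.
    rewrite -setCS setCK; apply/subsetP=> i; rewrite !inE => si.
    by have := leq_trans si (leq_trans (sm' i) (m'H i)); rewrite msetE setTD inE; case: (i \in H).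
  apply/bigmax_leqP=> F FB; have := ss F (proj2 (minprime_basis F) FB).
  rewrite /mprime_pow sE sum_mset msup_mset => le.
  have := cardsID (msup s) F; rewrite -(rank_setT matB FB) -rH setDE.
  rewrite (setIC (~: _)); move: le; move: #|_ :&: msup s| #|_ :&: ~: _| (rank H); lia.
by apply: mdivides_anti => //; rewrite setTD e setCK -sE.
Qed.

(** Dropping one variable lowers the order along each minimal prime by at most one, so a common
    generator would have a proper divisor in [SF] of level [h]. *)
Lemma SF_gens_disjoint h m :
  mgens (SF (cover_ideal B) h) m -> ~ mgens (SF (cover_ideal B) h.+1) m.
Proof.
move=> [_ minm] [[s [sqs sm ss]] _].
have es : s = m.
  apply: minm => //; exists s; split=> // F /ss; exact: leq_trans.
move: sqs ss {sm}; rewrite {}es {s} => sqm sm.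
have [F FB] := basis_exists matB.
have [i0 mi0] : exists i, (0 < m i)%N.
  have := sm F (proj2 (minprime_basis F) FB); rewrite /mprime_pow.
  case: (pickP (fun i => 0 < m i)%N) => [i mi|no]; first by exists i.
  by rewrite big1 // => i _; have := no i; rewrite lt0n => /negbFE/eqP.
have lem' : mdivides (m - U_(i0))%MM m by move=> i; rewrite mnmBE leq_subr.
have /mnmP/(_ i0) : (m - U_(i0))%MM = m.
  apply: minm => //; exists (m - U_(i0))%MM; split=> //.
    by move=> i; apply: leq_trans (sqm i).
  move=> F' /sm; rewrite /mprime_pow => le; rewrite -ltnS; apply: leq_trans le _.
  apply: (@leq_trans (\sum_(i in F') ((m - U_(i0))%MM i + (i == i0)))).
    by apply: leq_sum => i _; rewrite mnmBE mnm1E [i0 == i]eq_sym [X in (_ <= X)%N]addnC -leq_subLR.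
  rewrite big_split /= -addn1 leq_add2l.
  apply: leq_trans (_ : \sum_i (i == i0) <= 1)%N.
    by rewrite [X in (_ <= X)%N](bigID (mem F')) /= leq_addr.
  by rewrite (bigD1 i0) //= eqxx big1 // => i /negbTE->.
by rewrite mnmBE mnm1E eqxx; move: mi0; case: (m i0) => // k _;
  rewrite subn1 /= => e; move: (ltnSn k); rewrite -[X in (_ < X)%N]e ltnn.
Qed.

End Generators.

(** * The iterated-contraction order *)

Section ContractionOrder.
Variables (n c : nat) (B : {set {set 'I_n}}) (v : 'I_c -> 'I_n).
Variable ord : 'X_{1..n} -> 'X_{1..n} -> Prop.
Hypotheses (matB : is_matroid B) (v_inj : injective v).
Hypothesis v_basis : [set v k | k : 'I_c] \in B.
Local Notation hyperplane := (coatom B setT).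
Local Notation prec := (prec B v ord).

Lemma rank_setT_basis : rank B setT = c.
Proof. by rewrite (rank_setT matB v_basis) card_imset // card_ord. Qed.

Lemma vset_sub i j : (i <= j)%N -> vset v i \subset vset v j.
Proof.
move=> ij; apply/subsetP=> _ /imsetP[k ki ->]; apply/imsetP; exists k => //.
by move: ki; rewrite !inE => /leq_trans; apply.
Qed.

Lemma indep_vset i : indep B (vset v i).
Proof.
apply/existsP; exists [set v k | k : 'I_c]; rewrite v_basis /=.
by apply/subsetP=> _ /imsetP[k _ ->]; apply: imset_f.
Qed.

Lemma vsetS i (lt_ic : (i < c)%N) : vset v i.+1 = v (Ordinal lt_ic) |: vset v i.
Proof.
apply/eqP; rewrite eqEsubset subUset sub1set vset_sub // andbT; apply/andP; split; last first.
  by apply: imset_f; rewrite inE /=.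
apply/subsetP=> _ /imsetP[k ki ->]; rewrite !inE; move: ki; rewrite inE ltnS leq_eqVlt.
case/predU1P=> [e|ki]; last by apply/orP; right; apply: imset_f; rewrite inE.
by apply/orP; left; apply/eqP; congr v; apply: val_inj.
Qed.

Lemma vset_hyperplane H : hyperplane H -> ~~ (vset v c \subset H).
Proof.
case/and3P=> _ _ /eqP rH; apply/negP=> s; have := rankS matB s.
have e : vset v c = [set v k | k : 'I_c].
  by apply/setP=> x; apply/imsetP/imsetP=> -[k _ ->]; exists k; rewrite // inE ltn_ord.
have := rank_indep (indep_vset c) (subxx _); rewrite {1}e card_imset // card_ord.
have := rank_setT_basis; rewrite -rH; move: (rank B H) (rank B (vset v c)); lia.
Qed.

(** So the index of a generator is the length of the longest initial segment of the ordered basis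
    inside its hyperplane. *)
Lemma pieceE i N : piece B v i N <->
  exists H, [/\ hyperplane H, vset v i \subset H, ~~ (vset v i.+1 \subset H) &
                N = mset (setT :\: H)].
Proof.
rewrite /piece /Jc !gens_contrE ?indep_vset //; split.
  case=> -[H [cH sH ->]] nH; exists H; split=> //; apply/negP=> s; apply: nH.
  by exists H.
case=> H [cH sH nH ->]; split; first by exists H.
by case=> H' [_ sH' /mset_inj]; rewrite !setTD => /setC_inj e; rewrite e sH' in nH.
Qed.

Lemma piece_GJ i N : piece B v i N -> GJ B N.
Proof. by case/pieceE=> H [cH _ _ e]; apply/(GJE matB); exists H. Qed.

Lemma hyperplane_piece H j : hyperplane H -> vset v j \subset H ->
  exists i, [/\ (j <= i)%N, (i < c)%N, vset v i \subset H & ~~ (vset v i.+1 \subset H)].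
Proof.
move=> cH sj; have ex : exists k, ~~ (vset v k \subset H).
  by exists c; apply: vset_hyperplane.
(* The index sought is one less than the first length at which the initial segment leaves [H]. *)
case: (ex_minnP ex) => -[|k] nk mink.
  by case/negP: nk; apply: subset_trans sj; apply: vset_sub.
exists k; split=> //.
- rewrite leqNgt; apply/negP=> kj; case/negP: nk; apply: subset_trans sj; exact: vset_sub.
- by rewrite ltnNge; apply/negP=> ck; have := mink c (vset_hyperplane cH); lia.
- by apply: contraT => /mink; rewrite ltnn.
Qed.

Lemma GJ_piece N : GJ B N -> exists2 i, (i < c)%N & piece B v i N.
Proof.
case/(GJE matB)=> H cH ->.
have [|i [_ ic si nsi]] := @hyperplane_piece H 0 cH.
  by apply/subsetP=> x /imsetP[k]; rewrite inE.
by exists i => //; apply/pieceE; exists H.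
Qed.

Lemma piece_uniq i j N : piece B v i N -> piece B v j N -> i = j.
Proof.
case/pieceE=> H [_ si nsi ->] /pieceE[H' [_ sj nsj]] /mset_inj.
rewrite !setTD => /setC_inj e; move: sj nsj; rewrite -{}e => sj nsj.
case: (ltngtP i j) => // lt; [case/negP: nsi|case/negP: nsj].
  by apply: subset_trans sj; apply: vset_sub.
by apply: subset_trans si; apply: vset_sub.
Qed.

(** * The strict total order [prec], its colon ideals and the iterated cones *)

Hypothesis ord_total : forall i, (i < c)%N ->
     [/\ (forall N, piece B v i N -> ~ ord N N),
         (forall N1 N2 N3, piece B v i N1 -> piece B v i N2 -> piece B v i N3 ->
            ord N1 N2 -> ord N2 N3 -> ord N1 N3) &
         (forall N1 N2, piece B v i N1 -> piece B v i N2 -> N1 <> N2 ->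
            ord N1 N2 \/ ord N2 N1)].

Lemma prec_irr N : ~ prec N N.
Proof.
case=> i [j [ic _ pi pj h]]; move: h; rewrite -(piece_uniq pi pj) ltnn => -[//|[_ oN]].
by have [irr _ _] := ord_total ic; apply: irr pi oN.
Qed.

Lemma prec_trans N1 N2 N3 : prec N1 N2 -> prec N2 N3 -> prec N1 N3.
Proof.
case=> i [j [ic jc pi pj h]] [j' [k [_ kc pj' pk h']]].
move: h'; rewrite -(piece_uniq pj pj') => h'; exists i, k; split=> //.
case: h h' => [ji|[ij o]] [kj|[jk o']].
- by left; apply: ltn_trans kj ji.
- by left; rewrite -jk.
- by left; rewrite ij.
right; split; first by rewrite ij.
have [_ tr _] := ord_total ic; move: pj pk; rewrite -jk -ij => pj pk.
by apply: tr o o'.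
Qed.

Lemma prec_total N N' : GJ B N -> GJ B N' -> N <> N' -> prec N N' \/ prec N' N.
Proof.
move=> /GJ_piece[i ic pi] /GJ_piece[j jc pj] ne.
case: (ltngtP i j) => [ij|ji|ij].
- by right; exists j, i; split=> //; left.
- by left; exists i, j; split=> //; left.
have [_ _ tot] := ord_total ic; move: pj; rewrite -ij => pj.
by case: (tot N N' pi pj ne) => o; [left|right]; exists i, i; split=> //; right.
Qed.

Lemma prec_GJ N N' : prec N N' -> GJ B N.
Proof. by case=> i [j [_ _ /piece_GJ]]. Qed.

(** Higher pieces come first: hyperplanes of predecessors contain [vset v i], and those containing
    [vset v i.+1] all give predecessors. The two colon lemmas, with [x] the basis element of index
    [i], give the two inclusions. *)
Lemma colon_interval N : GJ B N -> exists H i,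
  [/\ hyperplane H, vset v i \subset H, N = mset (setT :\: H) &
      forall m, colon_ideal B v ord N m <-> interval_ideal B (vset v i) H m].
Proof.
move=> /GJ_piece[i ic pi]; have /pieceE[H [cH si nsi NE]] := pi.
exists H, i; split=> // m; split.
  case=> N' [_ p dv]; have [j [i' [jc _ pj pi' h]]] := p.
  have /pieceE[H' [cH' sj nsj N'E]] := pj.
  have sH' : vset v i \subset H'.
    apply: subset_trans sj; apply: vset_sub; rewrite (piece_uniq pi pi').
    by case: h => [/ltnW|[->]].
  apply: (interval_of_colon matB cH cH') => //; last by rewrite -N'E -NE.
  move=> HH'; have NN' : N' = N by rewrite N'E NE HH'.
  by apply: (@prec_irr N); rewrite -{1}NN'.
move=> mI; have sx := vsetS ic; move: nsi; rewrite sx subUset sub1set si andbT => xH.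
have [H' [cH' xH' dv]] := colon_of_interval matB (flat_setT B) cH (in_setT _) xH mI.
rewrite -sx in xH'; have [j [ij jc sj nsj]] := hyperplane_piece cH' xH'.
have pj : piece B v j (mset (setT :\: H')) by apply/pieceE; exists H'.
exists (mset (setT :\: H')); split; [exact: piece_GJ pj| |by rewrite NE].
by exists j, i; split=> //; left.
Qed.

Lemma colon_res_degs (K : fieldType) N (F : cx K n) h :
  GJ B N -> is_min_res (colon_ideal B v ord N) F -> (1 <= h)%N ->
  msub (mdeg_shift F N h.-1) (mgens (SF (cover_ideal B) h)).
Proof.
move=> /colon_interval[H [i [cH sH -> colE]]] minF h1 m [j <-].
have /and3P[fH _ /eqP rH] := cH.
have [G [resG degG]] := interval_resolution matB K fH sH.
have resG' : is_res (colon_ideal B v ord (mset (setT :\: H))) G.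
  by apply: is_res_ext resG => m'; rewrite colE.
have [k ->] := min_res_degs minF resG' j.
have [H' [fH' H'H rH' ->]] := degG _ k.
rewrite msetD ?subsetT //; apply: SF_gens => //.
by rewrite -rH -rH' -addnS prednK.
Qed.

(** The ideal $J_{\preceq N}$. *)
Definition initial_ideal N : mideal n :=
  fun m => exists N', [/\ GJ B N', N' = N \/ prec N' N & mdivides N' m].

(** Generators are squarefree, so predecessors are recorded by their supports; this gives a finite
    set whose size measures the position of [N]. *)
Definition predecessors N : {set {set 'I_n}} :=
  [set S | excluded_middle_informative (prec (mset S) N)].

Lemma predecessorsP S N : reflect (prec (mset S) N) (S \in predecessors N).
Proof. by rewrite inE; case: excluded_middle_informative => h; constructor. Qed.

Lemma card_predecessors N N' : prec N N' -> (#|predecessors N| < #|predecessors N'|)%N.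
Proof.
move=> NN'; apply: proper_card; apply/properP; split.
  by apply/subsetP=> S /predecessorsP h; apply/predecessorsP; apply: prec_trans NN'.
have /(GJE matB)[H _ NE] := prec_GJ NN'.
exists (setT :\: H); first by apply/predecessorsP; rewrite -NE.
by apply/predecessorsP; rewrite -NE; apply: prec_irr.
Qed.

Lemma pred_exists N : GJ B N -> ~ is_min_elt B v ord N ->
  exists Nm, is_pred B v ord Nm N.
Proof.
move=> GN notmin.
have [S0 S0N] : exists S, S \in predecessors N.
  apply: NNPP => none; apply: notmin; split=> // N' /(GJE matB)[H _ ->] h.
  by apply: none; exists (setT :\: H); apply/predecessorsP.
(* A generator below [N] with the most predecessors has nothing between it and [N]. *)
have [S /predecessorsP SN maxS] :=
  @arg_maxnP _ S0 (mem (predecessors N)) (fun S => #|predecessors (mset S)|) S0N.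
exists (mset S); split=> //; first exact: prec_GJ SN.
move=> N' /(GJE matB)[H _ ->] [/card_predecessors lt /predecessorsP h].
by have := maxS _ h; rewrite /= leqNgt lt.
Qed.

Lemma iter_cone_res (K : fieldType) (I : 'X_{1..n} -> cx K n) :
  iter_cone B v ord I -> forall N, GJ B N ->
  is_res (initial_ideal N) (I N) /\
  forall h, (1 <= h)%N -> msub (mdegs (I N) h) (mgens (SF (cover_ideal B) h)).
Proof.
move=> [Imin Ipred] N; have [d] := ubnP #|predecessors N|; elim: d N => // d IH N Nd GN.
have [minN|notmin] := classic (is_min_elt B v ord N).
  have [[r0 r1] r2 d0 d1 m0] := Imin N minN; split.
    apply: is_res_ext (principal_is_res r0 r1 r2 d0 d1 m0) => m.
    split=> [h|[N' [GN' [->|lt] //]]]; first by exists N; split=> //; left.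
    by case: minN => _ /(_ N' GN').
  (* Only homological degree one occurs, and a hyperplane has corank one. *)
  move=> h h1 m [j <-]; rewrite addm0; case: h h1 j => [//|[|h]] _ j; last first.
    by exfalso; case: j; rewrite r2.
  rewrite d1; have /(GJE matB)[H cH ->] := GN.
  by case/and3P: cH => fH _ /eqP rH; apply: SF_gens => //; rewrite addn1.
have [Nm pN] := pred_exists GN notmin; have [GNm _ lt no] := pN.
have [F [phi [minF cmp IE]]] := Ipred Nm N pN.
have [|resm degm] := IH Nm _ GNm; first by apply: leq_trans (card_predecessors lt) _.
(* Hence $J_{\prec N}$ is the ideal resolved by [I Nm], and the colon ideal of [N] is taken with
   respect to it. *)
have below N' : GJ B N' -> prec N' N <-> N' = Nm \/ prec N' Nm.
  move=> GN'; split=> [h|[->//|h]]; last exact: prec_trans h lt.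
  have [->|/eqP ne] := eqVneq N' Nm; first by left.
  by have [h'|h'] := prec_total GN' GNm ne; [right|case: (no N' GN')].
rewrite IE; split.
  apply: (cone_is_res resm (proj1 minF) cmp) => m; split.
  - by case=> N' [GN' h dv]; exists N'; split=> //; apply/below.
  - by case=> N' [GN' h dv]; exists N'; split=> //; apply/below.
  - case=> N' [GN' [->|h] dv]; [by right|left].
    by exists N'; split=> //; apply/below.
  - case=> [[N' [GN' h dv]]|dv]; last by exists N; split=> //; left.
    by exists N'; split=> //; right; apply/below.
move=> h h1 m [j <-]; rewrite addm0.
have [[a ->]|[k [b [hk ->]]]] := cone_deg j.
  by apply: degm => //; exists a; rewrite addm0.
apply: (colon_res_degs GN minF h1); rewrite hk /=; by exists b.
Qed.

End ContractionOrder.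

(** A nonzero constant coefficient in a differential would force equal multidegrees in consecutive
    homological degrees, against [SF_gens_disjoint]. *)
Lemma minimal_of_degs (K : fieldType) n (B : {set {set 'I_n}}) (I : mideal n) (F : cx K n) :
  is_matroid B -> is_res I F ->
  (forall h, (1 <= h)%N -> msub (mdegs F h) (mgens (SF (cover_ideal B) h))) ->
  is_minimal F.
Proof.
move=> matB [[_ d0] hF _ _ _] degs i a b.
have degF h j : mgens (SF (cover_ideal B) h) (deg F h j).
  case: h j => [|h] j; last by apply: degs => //; exists j; rewrite addm0.
  (* In homological degree zero the multidegree is 1, which generates [SF] of level zero. *)
  rewrite d0; split=> [|m _ m0]; last by apply: mdivides_anti m0 _ => k; rewrite mnm0E.
  by exists 0%MM; split=> // k; rewrite mnm0E.
have [k [-> h]] := hF i a b; rewrite mcoeffZ mcoeffX.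
have [->|k0] := eqVneq k 0%R; first by rewrite mul0r.
have /mnm_lepP le := h k0.
have [/mnmP e|_] := eqVneq; last by rewrite mulr0.
have e' : deg F i a = deg F i.+1 b.
  by apply/mnmP=> l; move: (e l) (le l); rewrite mnmBE mnm0E; lia.
by case: (SF_gens_disjoint matB (degF i a)); rewrite e'.
Qed.

Local Open Scope ring_scope.

Theorem theorem5p4 (K : fieldType) (n c : nat) (B : {set {set 'I_n}})
    (v : 'I_c -> 'I_n) (ord : 'X_{1..n} -> 'X_{1..n} -> Prop) :
  is_matroid B ->
  (1 <= c)%N ->
  injective v ->
  [set v k | k : 'I_c] \in B ->
  (* arbitrary total orders on the sets G(J_i) - G(J_{i+1}) *)
  (forall i, (i < c)%N ->
     [/\ (forall N, piece B v i N -> ~ ord N N),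
         (forall N1 N2 N3, piece B v i N1 -> piece B v i N2 -> piece B v i N3 ->
            ord N1 N2 -> ord N2 N3 -> ord N1 N3) &
         (forall N1 N2, piece B v i N1 -> piece B v i N2 -> N1 <> N2 ->
            ord N1 N2 \/ ord N2 N1)]) ->
  (* first assertion *)
  (forall N, GJ B N -> ~ is_min_elt B v ord N ->
     forall F : cx K n, is_min_res (colon_ideal B v ord N) F ->
     forall h, (1 <= h)%N ->
       msub (mdeg_shift F N h.-1) (mgens (SF (cover_ideal B) h))) /\
  (* consequences for iterated mapping cones *)
  (forall I : 'X_{1..n} -> cx K n, iter_cone B v ord I ->
     (forall N, GJ B N -> forall h, (1 <= h)%N ->
        msub (mdegs (I N) h) (mgens (SF (cover_ideal B) h))) /\
     (forall Nmax, is_max_elt B v ord Nmax ->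
        is_min_res (cover_ideal B) (I Nmax))).
Proof.
move=> matB _ v_inj v_basis ord_total; split=> [N GN _ F minF h|I iterI].
  exact: (colon_res_degs matB v_inj v_basis ord_total GN minF).
have resI := iter_cone_res matB v_inj v_basis ord_total iterI.
split=> [N /resI[]//|Nmax [GNmax maxN]].
have [resN degN] := resI Nmax GNmax.
split; last exact: minimal_of_degs matB resN degN.
(* By totality every other generator precedes [Nmax], so its initial ideal is all of J. *)
apply: is_res_ext resN => m; split.
  by case=> N' [[N'J _] _ dv] F /N'J[i iF ?]; exists i => //; apply: leq_trans (dv i).
move=> /(cover_ideal_gen matB)[N' GN' dv]; exists N'; split=> //.
have [->|/eqP ne] := eqVneq N' Nmax; first by left.
right; have [//|lt] := prec_total matB v_inj v_basis ord_total GN' GNmax ne.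
by case: (maxN N' GN').
Qed.
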